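(* Let $f:\mathbb R\to\mathbb R$, $f(x)=\frac12x^2$. Fix any deterministic initial point $x_{\mathrm{init}}\in\mathbb R$, any deterministic constant stepsize $\gamma>0$, and any integer horizon $T\ge10$. If $0<\gamma<1$, put $$R_{\gamma,T}:=\gamma^2\sum_{r=0}^{T-\lfloor T/2\rfloor-1}(1-\gamma)^{2r}.$$ Define $$\delta_{\gamma,x_{\mathrm{init}},T}:=\begin{cases}\min\left\{\frac1{64},\ \exp\left(-\frac1{32R_{\gamma,T}\sqrt T}\right),\ \exp\left(-\frac1{\sqrt{32\gamma TR_{\gamma,T}}}\right)\right\},&0<\gamma<1,\\ \frac1{64},&\gamma\ge1.\end{cases}$$ Then for every $0<\delta<\delta_{\gamma,x_{\mathrm{init}},T}$ there exists $A\ge1$ (allowed to depend on $\delta,\gamma,T$) such that, if $\xi_1,\dots,\xi_T$ are i.i.d. with the three-point law $$\mathbb P(\xi_t=A)=\mathbb P(\xi_t=-A)=\frac1{2A^2},\qquad \mathbb P(\xi_t=0)=1-\frac1{A^2},$$ the SGD iterates $x_1=x_{\mathrm{init}}$, $x_{t+1}=x_t-\gamma(x_t+\xi_t)$ for $t=1,\dots,T-1$, satisfy $$\mathbb P\left(\frac1T\sum_{t=1}^T|f'(x_t)|^2\ \ge\ \frac1{512\,\delta\sqrt T\log(1/\delta)}\right)>\delta.$$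
   Context: The stochastic oracle is $g(x;\xi)=f'(x)+\xi=x+\xi$. For the three-point law above $\mathbb E[\xi_t]=0$ and $\mathbb E[\xi_t^2]=1$, so the oracle is unbiased with variance $1$; $f$ is $1$-smooth and bounded below. *)

(* Defs.v *)
From mathcomp Require Export all_boot all_order all_algebra.
From mathcomp Require Export finmap.
From mathcomp Require Export all_classical all_reals all_analysis.

Set Implicit Arguments.
Unset Strict Implicit.
Unset Printing Implicit Defensive.

Import Order.TTheory GRing.Theory Num.Theory.
Import numFieldNormedType.Exports.

Local Open Scope classical_set_scope.
Local Open Scope ring_scope.

Definition half_square (R : realType) (x : R) : R := 2^-1 * x ^+ 2.

(* The sum runs over r = 0, ..., T - floor(T/2) - 1. *)
Definition Rsum (R : realType) (gamma : R) (T : nat) : R :=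
  gamma ^+ 2 * \sum_(0 <= r < T - T %/ 2) (1 - gamma) ^+ (2 * r).

(* Intended for 0 < gamma. The threshold does not depend on the initial
   point. *)
Definition delta_threshold (R : realType) (gamma : R) (T : nat) : R :=
  if gamma < 1 then
    Num.min (1 / 64)
      (Num.min
        (expR (- (1 / (32 * Rsum gamma T * Num.sqrt T%:R))))
        (expR (- (1 / Num.sqrt (32 * gamma * T%:R * Rsum gamma T)))))
  else 1 / 64.

Definition independent_RVs d (Omega : measurableType d) (R : realType)
    (P : probability Omega R) (K : choiceType) (I : set K)
    (X : K -> {RV P >-> R}) : Prop :=
  forall (J : {fset K}) (B : K -> set R),
    [set` J] `<=` I ->
    (forall i, i \in J -> measurable (B i)) ->
    P (\bigcap_(i in [set` J]) (X i @^-1` B i)) =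
    (\prod_(i <- J) P (X i @^-1` B i))%E.

(* The masses sum to 1, so for A <> 0 these equations determine the law
   of X. *)
Definition three_point_law d (Omega : measurableType d) (R : realType)
    (P : probability Omega R) (A : R) (X : {RV P >-> R}) : Prop :=
  [/\ P (X @^-1` [set A]) = (1 / (2 * A ^+ 2))%:E,
      P (X @^-1` [set - A]) = (1 / (2 * A ^+ 2))%:E &
      P (X @^-1` [set 0]) = (1 - 1 / A ^+ 2)%:E].

(* Only x 1, ..., x T are constrained. *)
Definition sgd_iterates (R : realType) (Omega : Type) (gamma xinit : R)
    (T : nat) (xi x : nat -> Omega -> R) : Prop :=
  (forall w, x 1%N w = xinit) /\
  (forall t w, (1 <= t < T)%N ->
     x t.+1 w = x t w - gamma * (x t w + xi t w)).

(* Main.v *)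
(* Take A^2 = T / (8 delta) and look at the runs in which exactly one noise
   variable xi_s with s <= T/2 is nonzero. The jump contributes at least
   A^2 Rsum gamma T to the sum of the x_t^2, provided its sign is chosen so that
   its cross term with the noiseless trajectory is nonnegative; this makes the
   bound independent of the initial point. These events are disjoint in s, and
   each has probability (1 - A^-2)^(T-1) / (2 A^2), so by Bernoulli's inequality
   their union has probability > delta. The threshold on delta is what turns
   A^2 Rsum gamma T / T into the required lower bound. *)
Require Import Defs.
From mathcomp Require Import ring lra zify measurable_realfun.

Set Implicit Arguments.
Unset Strict Implicit.
Unset Printing Implicit Defensive.

Import Order.TTheory GRing.Theory Num.Theory.
Import numFieldNormedType.Exports.

Local Open Scope classical_set_scope.
Local Open Scope ring_scope.

(** * Elementary calculus and inequalities *)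

Lemma derive1_half_square (R : realType) (x : R) :
  derive1 (@half_square R) x = x.
Proof.
rewrite derive1E /half_square.
have -> : (fun x : R => 2^-1 * x ^+ 2) = 2^-1 \*: ((@id R) ^+ 2).
  by apply/funext => y.
rewrite deriveZ //= deriveX //= derive_id.
by rewrite /GRing.scale /= expr1 mulr1 -mulr_natl; field.
Qed.

Lemma bernoulli_ineq (R : realDomainType) (e : R) (n : nat) :
  0 <= e <= 1 -> 1 - e *+ n <= (1 - e) ^+ n.
Proof.
move=> /andP[e0 e1]; elim: n => [|n IH]; first by rewrite mulr0n subr0 expr0.
have en0 : 0 <= e *+ n by rewrite mulrn_wge0.
rewrite exprS; apply: le_trans (_ : (1 - e) * (1 - e *+ n) <= _).
  by rewrite mulrS; nra.
by rewrite ler_wpM2l // subr_ge0.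
Qed.

(** * Deterministic lower bound from a single jump *)

(** In the expanded square the cross sum has coefficient -2, so it and the squares of [a] only help.
    Later [a] is the noiseless trajectory and [b] the jump response. *)
Lemma sum_sqr_ge_of_cross_le0 (R : realDomainType) (I : Type) (r : seq I)
    (a b : I -> R) :
  \sum_(i <- r) a i * b i <= 0 ->
  \sum_(i <- r) b i ^+ 2 <= \sum_(i <- r) (a i - b i) ^+ 2.
Proof.
move=> ab0.
have -> : \sum_(i <- r) (a i - b i) ^+ 2 = \sum_(i <- r) a i ^+ 2
    - 2 * (\sum_(i <- r) a i * b i) + \sum_(i <- r) b i ^+ 2.
  rewrite mulr_sumr -sumrB -big_split /=.
  by apply: eq_bigr => i _; ring.
rewrite lerDr; have : 0 <= \sum_(i <- r) a i ^+ 2.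
  by apply: sumr_ge0 => i _; exact: sqr_ge0.
by lra.
Qed.

(* Response of the iterates at time t to a unit jump at time s, up to the factor
   - gamma. *)
Definition impulse (R : realType) (gamma : R) (s t : nat) : R :=
  if (s < t)%N then (1 - gamma) ^+ (t - s.+1) else 0.

(** The recursion is linear, so the decaying initial value and the response to the jump
    superpose. *)
Lemma sgd_single_jump (R : realType) (gamma c : R) (T s : nat)
    (xi x : nat -> R) :
  (1 <= s <= T)%N ->
  (forall t, (1 <= t < T)%N -> x t.+1 = x t - gamma * (x t + xi t)) ->
  (forall t, (1 <= t <= T)%N -> xi t = if t == s then c else 0) ->
  forall t, (1 <= t <= T)%N ->
    x t = (1 - gamma) ^+ t.-1 * x 1%N - gamma * c * impulse gamma s t.
Proof.
move=> sT xS xiE; elim=> [//|t IH] tT; case: t IH tT => [|t] IH tT.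
  by rewrite /impulse ltnNge; case/andP: sT => -> _ /=; rewrite mulr0; ring.
rewrite xS; last by lia.
rewrite xiE; last by lia.
rewrite IH; last by lia.
(* Noise at time [s] is first felt at [s.+1]: the cases are before, after and at the jump. *)
rewrite /impulse /= exprS; case: (ltngtP t.+1 s) => ts.
- by rewrite ltnS leqNgt ts /=; ring.
- by rewrite ltnS (ltnW ts) [(t.+2 - _)%N]subSn // [_ ^+ (_ - _).+1]exprS; ring.
- by rewrite -ts ltnSn subnn expr0; ring.
Qed.

(** A jump at [s] is felt with exponents 0, ..., T - s - 1, and [s <= T %/ 2] makes this range
    contain that of [Rsum]. The surplus terms are squares, whatever the sign of [1 - gamma]. *)
Lemma Rsum_le_impulse (R : realType) (gamma : R) (T s : nat) :
  (1 <= s <= T %/ 2)%N ->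
  Rsum gamma T <= \sum_(1 <= t < T.+1) (gamma * impulse gamma s t) ^+ 2.
Proof.
move=> sT.
rewrite /Rsum mulr_sumr [leRHS](@big_cat_nat _ _ _ s.+1) //=; last by lia.
apply: ler_wpDl; first by apply: sumr_ge0 => i _; exact: sqr_ge0.
rewrite [leRHS](_ : _ =
    \sum_(0 <= r < T - s) (gamma * impulse gamma s (r + s.+1)) ^+ 2); last first.
  by rewrite -{1}[s.+1]add0n big_addn subSS.
rewrite [leRHS](@big_cat_nat _ _ _ (T - T %/ 2)) //=; last by lia.
apply: ler_wpDr; first by apply: sumr_ge0 => i _; exact: sqr_ge0.
apply: ler_sum => r _; rewrite /impulse.
by rewrite addnS ltnS leq_addl subSS addnK exprMn -exprM mulnC.
Qed.

(** The cross sum is linear in [c], so one of the two signs makes it nonpositive. The sign is fixed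
    before [xi] and [x], hence is deterministic. *)
Lemma exists_jump_sign (R : realType) (gamma A xinit : R) (T s : nat) :
  0 < A -> (1 <= s <= T %/ 2)%N ->
  exists2 c : R, c = A \/ c = - A &
  forall xi x : nat -> R, x 1%N = xinit ->
  (forall t, (1 <= t < T)%N -> x t.+1 = x t - gamma * (x t + xi t)) ->
  (forall t, (1 <= t <= T)%N -> xi t = if t == s then c else 0) ->
  A ^+ 2 * Rsum gamma T <= \sum_(1 <= t < T.+1) x t ^+ 2.
Proof.
move=> A0 sT.
pose a t := (1 - gamma) ^+ t.-1 * xinit.
pose b t := gamma * impulse gamma s t.
suff key c : c ^+ 2 = A ^+ 2 ->
    \sum_(1 <= t < T.+1) a t * (c * b t) <= 0 ->
    forall xi x : nat -> R, x 1%N = xinit ->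
    (forall t, (1 <= t < T)%N -> x t.+1 = x t - gamma * (x t + xi t)) ->
    (forall t, (1 <= t <= T)%N -> xi t = if t == s then c else 0) ->
    A ^+ 2 * Rsum gamma T <= \sum_(1 <= t < T.+1) x t ^+ 2.
  have cross c : \sum_(1 <= t < T.+1) a t * (c * b t) =
      c * \sum_(1 <= t < T.+1) a t * b t.
    by rewrite mulr_sumr; apply: eq_bigr => t _; ring.
  case: (lerP (\sum_(1 <= t < T.+1) a t * b t) 0) => ab.
    by exists A; [left|apply: key; rewrite // cross; nra].
  by exists (- A); [right|apply: key; rewrite ?sqrrN // cross; nra].
move=> cA cross xi x x1 xS xiE.
rewrite [leRHS](_ : _ = \sum_(1 <= t < T.+1) (a t - c * b t) ^+ 2).
  apply: le_trans (sum_sqr_ge_of_cross_le0 cross).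
  rewrite -cA; under eq_bigr do rewrite exprMn.
  by rewrite -mulr_sumr ler_wpM2l ?sqr_ge0 // Rsum_le_impulse.
rewrite !big_nat; apply: eq_bigr => t tT.
have sT' : (1 <= s <= T)%N by lia.
rewrite (sgd_single_jump sT' xS xiE) //.
by rewrite x1 /a /b; congr (_ ^+ 2); ring.
Qed.

(** * Probability of a noise pattern, and measurability *)

Lemma independent_pattern_prob d (Omega : measurableType d) (R : realType)
    (P : probability Omega R) (T s : nat) (xi : nat -> {RV P >-> R})
    (c p q : R) :
  independent_RVs [set t : nat | (1 <= t <= T)%N] xi ->
  (1 <= s <= T)%N ->
  P (xi s @^-1` [set c]) = p%:E ->
  (forall t, (1 <= t <= T)%N -> P (xi t @^-1` [set 0]) = q%:E) ->
  P (\bigcap_(t in [set t | (1 <= t <= T)%N])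
      xi t @^-1` [set if t == s then c else 0]) = (p * q ^+ T.-1)%:E.
Proof.
move=> indep sT Pp Pq.
have iotaE t : (t \in iota 1 T) = (1 <= t <= T)%N by rewrite mem_iota add1n ltnS.
pose J := [fset t in iota 1 T]%fset.
have JE : [set` J] = [set t | (1 <= t <= T)%N].
  by apply/seteqP; split => t /=; rewrite !inE iotaE.
rewrite -JE indep //; last by rewrite JE.
have perm : perm_eq J (iota 1 T).
  apply: uniq_perm => //; first exact: iota_uniq.
  by move=> t; rewrite !inE.
rewrite (perm_big _ perm) /= (bigD1_seq s) ?iota_uniq ?iotaE //=.
rewrite eqxx Pp EFinM; congr (_ * _)%E.
rewrite big_seq_cond (eq_bigr (fun=> q%:E)); last first.
  by move=> t /andP[tT /negPf ->]; rewrite Pq // -iotaE.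
rewrite -big_seq_cond prodEFin big_const_seq; congr EFin.
(* Removing [s] leaves T - 1 indices, hence the exponent of [q]. *)
have cnt := count_predC (pred1 s) (iota 1 T).
rewrite size_iota (count_uniq_mem _ (iota_uniq _ _)) iotaE sT in cnt.
by rewrite iter_mulr_1 -[in RHS]cnt.
Qed.

Lemma measurable_sgd d (Omega : measurableType d) (R : realType)
    (gamma xinit : R) (T : nat) (xi x : nat -> Omega -> R) :
  (forall t, (1 <= t <= T)%N -> measurable_fun setT (xi t)) ->
  sgd_iterates gamma xinit T xi x ->
  forall t, (1 <= t <= T)%N -> measurable_fun setT (x t).
Proof.
move=> mxi [x1 xS]; elim=> [//|[|t] IH] tT.
  by rewrite (_ : x 1%N = cst xinit) //; apply/funext => w; rewrite x1.
have -> : x t.+2 = (fun w => x t.+1 w - gamma * (x t.+1 w + xi t.+1 w)).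
  by apply/funext => w; rewrite xS.
have mx : measurable_fun setT (x t.+1) by apply: IH; lia.
have mxi' : measurable_fun setT (xi t.+1) by apply: mxi; lia.
apply: measurable_funB => //; apply: measurable_funM => //.
exact: measurable_funD.
Qed.

Lemma measurable_sum_sqr_ge d (Omega : measurableType d) (R : realType)
    (T : nat) (x : nat -> Omega -> R) (k c : R) :
  (forall t, (1 <= t <= T)%N -> measurable_fun setT (x t)) ->
  measurable [set w | k <= c * \sum_(1 <= t < T.+1) x t w ^+ 2].
Proof.
move=> mx; rewrite -[X in measurable X]setTI.
have -> : [set w | k <= c * \sum_(1 <= t < T.+1) x t w ^+ 2] =
   (fun w => c * \sum_(1 <= t < T.+1) x t w ^+ 2) @^-1` `[k, +oo[.
  by apply/seteqP; split => w /=; rewrite in_itv /= andbT.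
suff mf : measurable_fun setT (fun w => c * \sum_(1 <= t < T.+1) x t w ^+ 2).
  exact: mf.
apply: measurable_funM => //.
(* Out-of-range summands become 0, since [x t] is known to be measurable only for 1 <= t <= T. *)
under eq_fun do rewrite big_nat big_mkcond.
apply: measurable_sum => t; case: (boolP (1 <= t < T.+1)%N) => // tT.
by apply: measurable_funX; apply: mx; lia.
Qed.

(** * Consequences of the bound on [delta] *)

Lemma Rsum_ge_sqr (R : realType) (gamma : R) (T : nat) :
  (0 < T)%N -> gamma ^+ 2 <= Rsum gamma T.
Proof.
move=> T0; rewrite /Rsum big_ltn; last by lia.
rewrite muln0 expr0 mulrDr mulr1 lerDl mulr_ge0 ?sqr_ge0 //.
by apply: sumr_ge0 => r _; rewrite mulnC exprM sqr_ge0.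
Qed.

(** The second conclusion is the required lower bound once A^2 = T / (8 delta) is inserted, with 64
    = 512 / 8. For [gamma < 1] it comes from taking logarithms in the threshold, for [gamma >= 1]
    from [Rsum gamma T >= 1]. *)
Lemma log_threshold (R : realType) (gamma delta : R) (T : nat) :
  0 < gamma -> (0 < T)%N -> 0 < delta -> delta < delta_threshold gamma T ->
  delta < 1 / 64 /\
  1 <= 64 * Rsum gamma T * Num.sqrt T%:R * ln (1 / delta).
Proof.
move=> g0 T0 d0.
have S1 : 1 <= Num.sqrt T%:R :> R by rewrite -[leLHS]sqrtr1 ler_sqrt ?ler1n.
have RS := Rsum_ge_sqr gamma T0.
have R0 : 0 < Rsum gamma T by apply: lt_le_trans RS; rewrite exprn_gt0.
rewrite /delta_threshold [1 / delta]div1r lnV ?posrE //.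
case: (ltP gamma 1) => g1.
  rewrite !lt_min => /and3P[d64 dR _]; split=> //.
  have : ln delta < - (1 / (32 * Rsum gamma T * Num.sqrt T%:R)).
    by rewrite -[ltRHS]expRK ltr_ln ?posrE ?expR_gt0.
  rewrite ltrNr ltr_pdivrMr; last first.
    by apply: mulr_gt0; [exact: mulr_gt0|exact: lt_le_trans ltr01 S1].
  by move=> h; lra.
move=> d64; split=> //.
(* exp y >= 1 + y at y = ln delta *)
have Ld : 63 / 64 <= - ln delta.
  by have := expR_ge1Dx (ln delta); rewrite lnK ?posrE //; lra.
have g2 : 1 <= gamma ^+ 2 by rewrite exprn_ege1.
have RS1 : 1 <= Rsum gamma T * Num.sqrt T%:R by nra.
by nra.
Qed.

(** With e = 1 / A^2 = 8 delta / T, Bernoulli gives (1 - e)^(T-1) >= 1 - 8 delta >= 7/8. As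
    floor(T/2) >= T/3, the total is at least 7 delta / 6. *)
Lemma jump_prob_gt (R : realType) (delta : R) (T : nat) :
  (10 <= T)%N -> 0 < delta -> delta < 1 / 64 ->
  delta < (1 / (2 * (T%:R / (8 * delta))) *
           (1 - 1 / (T%:R / (8 * delta))) ^+ T.-1) *+ (T %/ 2).
Proof.
move=> T10 d0 d64.
have T10R : (10 : R) <= T%:R by rewrite ler_nat.
have n3 : (T%:R : R) <= 3 * (T %/ 2)%:R.
  by rewrite -natrM ler_nat; lia.
set e := 1 / (T%:R / (8 * delta)).
have eE : e = 8 * delta / T%:R.
  by rewrite /e; field; apply/andP; split; lra.
have eT : e * T%:R = 8 * delta by rewrite eE divfK //; lra.
have e0 : 0 < e by rewrite eE divr_gt0 ?mulr_gt0 //; lra.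
have -> : 1 / (2 * (T%:R / (8 * delta))) = e / 2.
  by rewrite /e; field; apply/andP; split; lra.
have e1 : e <= 1 by nra.
have q78 : 7 / 8 <= (1 - e) ^+ T.-1.
  apply: le_trans (bernoulli_ineq _ _); last by rewrite ltW.
  have : e *+ T.-1 <= e * T%:R.
    by rewrite -[e *+ _]mulr_natr ler_wpM2l ?(ltW e0) // ler_nat leq_pred.
  by rewrite eT; lra.
rewrite -mulr_natr.
apply: lt_le_trans (_ : e / 2 * (7 / 8) * (T %/ 2)%:R <= _).
  have : 8 * delta <= 3 * (e * (T %/ 2)%:R).
    by rewrite -eT mulrCA ler_wpM2l // ltW.
  by lra.
by rewrite ler_wpM2r // ler_wpM2l //; lra.
Qed.

(** * Assembling the disjoint single-jump events *)

Theorem theorem4 (R : realType) (gamma : R) (T : nat) (delta : R)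
    (gamma_gt0 : 0 < gamma) (T_ge10 : (10 <= T)%N)
    (delta_gt0 : 0 < delta) (delta_lt : delta < delta_threshold gamma T) :
  exists A : R, 1 <= A /\
    forall (xinit : R) (d : measure_display) (Omega : measurableType d)
      (P : probability Omega R)
      (xi : nat -> {RV P >-> R}) (x : nat -> Omega -> R),
    independent_RVs [set t : nat | (1 <= t <= T)%N] xi ->
    (forall t : nat, (1 <= t <= T)%N -> three_point_law A (xi t)) ->
    sgd_iterates gamma xinit T xi x ->
    (delta%:E <
     P [set w | (1 / (512 * delta * Num.sqrt T%:R * ln (1 / delta)) <=
                 1 / T%:R * \sum_(1 <= t < T.+1)
                              `|derive1 (@half_square R) (x t w)| ^+ 2)%R])%E.
Proof.
have T0 : (0 < T)%N by lia.
have [d64 logT] := log_threshold gamma_gt0 T0 delta_gt0 delta_lt.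
have T10R : (10 : R) <= T%:R by rewrite ler_nat.
have A2_ge1 : 1 <= T%:R / (8 * delta).
  by rewrite ler_pdivlMr ?mul1r; lra.
pose A : R := Num.sqrt (T%:R / (8 * delta)).
have A2 : A ^+ 2 = T%:R / (8 * delta) by rewrite sqr_sqrtr //; lra.
have A1 : 1 <= A by rewrite -[leLHS]sqrtr1 ler_sqrt //; lra.
have A0 : 0 < A by lra.
exists A; split=> // xinit d Omega P xi x indep law sgd.
have [x1 xS] := sgd.
under eq_set do under eq_bigr do
  rewrite derive1_half_square real_normK ?num_real //.
set k := 1 / _.
have kle : k <= 1 / T%:R * (A ^+ 2 * Rsum gamma T).
  have S0 : 0 < Num.sqrt T%:R :> R by rewrite sqrtr_gt0; lra.
  have L0 : 0 < ln (1 / delta) by rewrite ln_gt0 // ltr_pdivlMr //; lra.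
  rewrite A2 /k ler_pdivrMr; last by rewrite !mulr_gt0 //; lra.
  apply: le_trans logT _; rewrite le_eqVlt; apply/orP; left; apply/eqP.
  by field; apply/andP; split; lra.
(* Ordinals start at 0 and jump times at 1, so [i] encodes a jump at [i.+1]. *)
have sT (i : 'I_(T %/ 2)) : (1 <= i.+1 <= T %/ 2)%N by have := ltn_ord i; lia.
have sT' (i : 'I_(T %/ 2)) : (1 <= i.+1 <= T)%N by have := ltn_ord i; lia.
(* Choice collects the favourable signs into one function of the jump time. *)
have [c cA jump] : exists2 c : 'I_(T %/ 2) -> R, forall i, c i = A \/ c i = - A &
    forall (i : 'I_(T %/ 2)) (z y : nat -> R), y 1%N = xinit ->
    (forall t, (1 <= t < T)%N -> y t.+1 = y t - gamma * (y t + z t)) ->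
    (forall t, (1 <= t <= T)%N -> z t = if t == i.+1 then c i else 0) ->
    A ^+ 2 * Rsum gamma T <= \sum_(1 <= t < T.+1) y t ^+ 2.
  exists (fun i => sval (cid2 (exists_jump_sign gamma xinit A0 (sT i)))) => i;
    by case: cid2.
pose E (i : 'I_(T %/ 2)) := \bigcap_(t in [set t | (1 <= t <= T)%N])
  (xi t @^-1` [set if t == i.+1 then c i else 0]).
have mE i : measurable (E i).
  by apply: bigcap_measurableType => t _; exact: measurable_funPTI.
have PE i : P (E i) = (1 / (2 * A ^+ 2) * (1 - 1 / A ^+ 2) ^+ T.-1)%:E.
  apply: independent_pattern_prob => // [|t tT]; last by have [] := law _ tT.
  by have [] := law _ (sT' i); case: (cA i) => ->.
have trivE : trivIset setT E.
  (* On a common point the noise at time [i.+1] would be both [c i], which is nonzero, and 0. *)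
  apply/trivIsetP => i j _ _ ij; apply/eqP/negP => /negP/set0P[w [Ei Ej]].
  have := Ei _ (sT' i); have := Ej _ (sT' i); rewrite /= eqxx => -> /eqP.
  rewrite eqSS (inj_eq val_inj) (negPf ij) => /eqP c0.
  by have := cA i; lra.
apply: lt_le_trans (_ : (P (\big[setU/set0]_(i < T %/ 2) E i) <= _)%E); last first.
  apply: le_measure; rewrite ?inE.
  - by apply: bigsetU_measurable => i _.
  - apply: measurable_sum_sqr_ge => t tT.
    by apply: measurable_sgd sgd _ tT => s _; exact: measurable_funPT.
  (* The deterministic bound is applied path by path, at each fixed [w]. *)
  - rewrite -bigcup_seq => w [i _ Ew] /=.
    apply: le_trans kle _; rewrite ler_wpM2l // ?divr_ge0 //.
    by apply: (jump i (xi ^~ w) (x ^~ w)) => // t tT; exact: xS.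
rewrite measure_bigsetU_ord // (eq_bigr _ (fun i _ => PE i)) sumEFin lte_fin.
by rewrite sumr_const card_ord A2 jump_prob_gt.
Qed.
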